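(* The asymptotic dimension of a (Gromov) hyperbolic metric graph $\mathcal{G}$ which admits a tame hierarchy is finite.
   Context: Graphs are connected metric graphs, not necessarily locally finite. Asymptotic dimension: a metric space $X$ has $\mathrm{asdim}(X)\leq n$ if for every $R>0$ there exists a covering of $X$ by uniformly bounded sets such that every metric $R$-ball intersects at most $n+1$ of the sets in the cover. A collection of metric spaces has $\mathrm{asdim}\leq n$ uniformly if for every $R>0$ there are such covers of each space whose elements are uniformly bounded over the whole collection. Electrification: given a graph $\mathcal{G}$ and a family $\mathcal{H}=\{H_c\mid c\in\mathcal{C}\}$ of complete connected subgraphs ($\mathcal{C}$ a countable, finite or empty index set), the $\mathcal{H}$-electrification $\mathcal{EG}$ of $\mathcal{G}$ is the graph obtained from $\mathcal{G}$ by adding, for every $c\in\mathcal{C}$, a new vertex $v_c$ which is connected to each vertex of $H_c$ by an edge and which is not connected to any other vertex. Relative hyperbolicity: $\mathcal{G}$ is hyperbolic relative to $\mathcal{H}$ if $\mathcal{EG}$ is Gromov hyperbolic and the following bounded penetration property holds. A simplicial path $\gamma$ in $\mathcal{EG}$ is efficient if for every $c\in\mathcal{C}$ we have $\gamma(k)=v_c$ for at most one $k$. For every $L>1$ there is a number $p(L)>0$ such that: if $\gamma$ is an efficient $L$-quasi-geodesic in $\mathcal{EG}$, $c\in\mathcal{C}$, $k\in\mathbb{Z}$ with $\gamma(k)=v_c$, and the distance in $H_c$ between $\gamma(k-1)$ and $\gamma(k+1)$ is at least $p(L)$, then every efficient $L$-quasi-geodesic $\gamma'$ in $\mathcal{EG}$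 with the same endpoints as $\gamma$ passes through $v_c$; moreover, if $\gamma'(k')=v_c$ then the distances in $H_c$ between $\gamma(k-1)$ and $\gamma'(k'-1)$ and between $\gamma(k+1)$ and $\gamma'(k'+1)$ are at most $p(L)$. As a standing assumption, for any such family of subgraphs there is a number $\delta>0$ such that each $H_c$ is $\delta$-hyperbolic. Hierarchy: a hierarchy of a hyperbolic metric graph $\mathcal{G}$ consists of a finite chain $\mathcal{G}_1,\dots,\mathcal{G}_k$ of hyperbolic graphs with the following properties: (1) $\mathcal{G}_k=\mathcal{G}$; (2) for all $i$, the graph $\mathcal{G}_{i+1}$ is hyperbolic relative to a family $\mathcal{H}_i$ of subgraphs, with electrification $\mathcal{G}_i$ (that is, $\mathcal{G}_i$ is the $\mathcal{H}_i$-electrification of $\mathcal{G}_{i+1}$). The graph $\mathcal{G}_1$ is called the base of the hierarchy, and $k$ its depth. The hierarchy is tame if its base has finite asymptotic dimension and if moreover for each $i$ there exists some $n_i$ such that the family $\mathcal{H}_i$ of subgraphs of $\mathcal{G}_{i+1}$ has $\mathrm{asdim}\leq n_i$ uniformly. *)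

(* Defs.v *)
From Stdlib Require Import Reals List FinFun ClassicalEpsilon.
Open Scope R_scope.

(** * Coarse geometry of a metric space [(X, d)] *)

Section Metric.
Variables (X : Type) (d : X -> X -> R).

Definition gromov_product (w x y : X) : R := (d x w + d y w - d x y) / 2.

Definition delta_hyperbolic (delta : R) : Prop :=
  forall w x y z : X,
    Rmin (gromov_product w x y) (gromov_product w y z) - delta
      <= gromov_product w x z.

Definition gromov_hyperbolic : Prop :=
  exists delta : R, 0 < delta /\ delta_hyperbolic delta.

Definition covers (U : (X -> Prop) -> Prop) : Prop :=
  forall x, exists A, U A /\ A x.

Definition bounded_by (D : R) (U : (X -> Prop) -> Prop) : Prop :=
  forall A, U A -> forall x y, A x -> A y -> d x y <= D.

Definition ball_meets (r : R) (x : X) (A : X -> Prop) : Prop :=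
  exists y, d x y <= r /\ A y.

Definition ball_multiplicity_le (r : R) (m : nat) (U : (X -> Prop) -> Prop)
  : Prop :=
  forall x, exists l : list (X -> Prop),
    (length l <= m)%nat /\ forall A, U A -> ball_meets r x A -> In A l.

Definition asdim_le (n : nat) : Prop :=
  forall r, 0 < r -> exists U,
    covers U /\ (exists D, bounded_by D U) /\ ball_multiplicity_le r (S n) U.

Definition finite_asdim : Prop := exists n, asdim_le n.

End Metric.

Definition uniform_asdim_le (I : Type) (X : I -> Type)
  (d : forall i, X i -> X i -> R) (n : nat) : Prop :=
  forall r, 0 < r -> exists D, forall i, exists U,
    covers (X i) U /\ bounded_by (X i) (d i) D U /\
    ball_multiplicity_le (X i) (d i) r (S n) U.

(** * Metric graphs *)

(** Loops and multiple edges are allowed.  The orientation of an edge given by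
    [src] and [tgt] only serves to parametrise it by [[0, 1]]. *)
Record graph := Graph {
  vertex : Type;
  edge : Type;
  src : edge -> vertex;
  tgt : edge -> vertex }.

Definition adjacent (G : graph) (u v : vertex G) : Prop :=
  exists e, (src G e = u /\ tgt G e = v) \/ (src G e = v /\ tgt G e = u).

Inductive walk (G : graph) : nat -> vertex G -> vertex G -> Prop :=
| walk_nil u : walk G 0 u u
| walk_cons n u v w : adjacent G u v -> walk G n v w -> walk G (S n) u w.

Definition connected (G : graph) : Prop :=
  inhabited (vertex G) /\ forall u v, exists n, walk G n u v.

(** Length of a shortest walk; junk value if there is none. *)
Definition vdist (G : graph) (u v : vertex G) : nat :=
  epsilon (inhabits 0%nat)
    (fun n => walk G n u v /\ forall m, walk G m u v -> (n <= m)%nat).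

(** The metric graph itself, all edges having length one: [Inner e t] is the
    point of the open edge [e] at distance [t] from [src e] along [e]. *)
Inductive point (G : graph) : Type :=
| Vert (v : vertex G)
| Inner (e : edge G) (t : R) (t01 : 0 < t < 1).

Arguments Vert {G} v.
Arguments Inner {G} e t t01.

Definition dist_to_vertex (G : graph) (p : point G) (v : vertex G) : R :=
  match p with
  | Vert u => INR (vdist G u v)
  | Inner e t _ =>
      Rmin (t + INR (vdist G (src G e) v)) (1 - t + INR (vdist G (tgt G e) v))
  end.

(** The path metric: a shortest path from [p] to [Inner f s] either enters the
    edge [f] through one of its ends, or stays inside [f]. *)
Definition dist (G : graph) (p q : point G) : R :=
  match q with
  | Vert v => dist_to_vertex G p v
  | Inner f s _ =>
      let via_ends := Rmin (s + dist_to_vertex G p (src G f))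
                           (1 - s + dist_to_vertex G p (tgt G f)) in
      match p with
      | Vert _ => via_ends
      | Inner e t _ =>
          if excluded_middle_informative (e = f)
          then Rmin (Rabs (t - s)) via_ends
          else via_ends
      end
  end.

Definition hyperbolic_graph (G : graph) : Prop :=
  gromov_hyperbolic (point G) (dist G).

Definition isomorphic (G G' : graph) : Prop :=
  exists (f : vertex G -> vertex G') (g : edge G -> edge G'),
    Bijective f /\ Bijective g /\
    forall e, (src G' (g e) = f (src G e) /\ tgt G' (g e) = f (tgt G e)) \/
              (src G' (g e) = f (tgt G e) /\ tgt G' (g e) = f (src G e)).

(** * Families of subgraphs and electrification *)

(** The complete (that is, full) subgraph spanned by a set of vertices. *)
Definition full_subgraph (G : graph) (P : vertex G -> Prop) : graph :=
  Graph {v : vertex G | P v} {e : edge G | P (src G e) /\ P (tgt G e)}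
    (fun e => exist P (src G (proj1_sig e)) (proj1 (proj2_sig e)))
    (fun e => exist P (tgt G (proj1_sig e)) (proj2 (proj2_sig e))).

Record subgraph_family (G : graph) := SubgraphFamily {
  index : Type;
  index_countable : exists f : index -> nat, Injective f;
  member_vertices : index -> vertex G -> Prop;
  member_connected : forall c, connected (full_subgraph G (member_vertices c)) }.

Arguments index {G} _.
Arguments member_vertices {G} _ _ _.

Definition member (G : graph) (H : subgraph_family G) (c : index H) : graph :=
  full_subgraph G (member_vertices H c).

Definition electrification (G : graph) (H : subgraph_family G) : graph :=
  Graph (vertex G + index H) (edge G + {c : index H & vertex (member G H c)})
    (fun e => match e with
              | inl e => inl (src G e)
              | inr (existT _ c v) => inl (proj1_sig v)
              end)
    (fun e => match e with
              | inl e => inl (tgt G e)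
              | inr (existT _ c v) => inr c
              end).

(** * Relative hyperbolicity *)

(** A finite simplicial path of length [n] is given by its vertices
    [gamma 0, ..., gamma n]; values of [gamma] beyond [n] are irrelevant. *)
Definition simplicial_path (G : graph) (n : nat) (gamma : nat -> vertex G)
  : Prop :=
  forall i, (i < n)%nat -> adjacent G (gamma i) (gamma (S i)).

Definition quasi_geodesic (G : graph) (L : R) (n : nat)
  (gamma : nat -> vertex G) : Prop :=
  forall i j, (i <= j <= n)%nat ->
    INR (j - i) / L - L <= INR (vdist G (gamma i) (gamma j))
      <= L * INR (j - i) + L.

Definition efficient (G : graph) (H : subgraph_family G) (n : nat)
  (gamma : nat -> vertex (electrification G H)) : Prop :=
  forall (c : index H) i j, (i <= n)%nat -> (j <= n)%nat ->
    gamma i = inr c -> gamma j = inr c -> i = j.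

Definition efficient_quasi_geodesic (G : graph) (H : subgraph_family G) (L : R)
  (n : nat) (gamma : nat -> vertex (electrification G H)) : Prop :=
  simplicial_path (electrification G H) n gamma /\
  quasi_geodesic (electrification G H) L n gamma /\
  efficient G H n gamma.

(** [gamma] visits [v_c] at time [S k], entering it from the vertex [x] of
    [H_c] and leaving it to the vertex [y] of [H_c]. *)
Definition passes_through (G : graph) (H : subgraph_family G) (n : nat)
  (gamma : nat -> vertex (electrification G H)) (c : index H) (k : nat)
  (x y : vertex (member G H c)) : Prop :=
  (S (S k) <= n)%nat /\ gamma k = inl (proj1_sig x) /\
  gamma (S k) = inr c /\ gamma (S (S k)) = inl (proj1_sig y).

(** The condition on [gamma] forces [v_c] not to be an endpoint of [gamma],
    hence not of [gamma'] either. *)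
Definition bounded_penetration (G : graph) (H : subgraph_family G) : Prop :=
  forall L, 1 < L -> exists p, 0 < p /\
    forall n gamma n' gamma',
      efficient_quasi_geodesic G H L n gamma ->
      efficient_quasi_geodesic G H L n' gamma' ->
      gamma' 0%nat = gamma 0%nat -> gamma' n' = gamma n ->
      forall (c : index H) k (x y : vertex (member G H c)),
        passes_through G H n gamma c k x y ->
        p <= INR (vdist (member G H c) x y) ->
        (exists i, (i <= n')%nat /\ gamma' i = inr c) /\
        forall k' (x' y' : vertex (member G H c)),
          passes_through G H n' gamma' c k' x' y' ->
          INR (vdist (member G H c) x x') <= p /\
          INR (vdist (member G H c) y y') <= p.

Definition hyperbolic_relative_to (G : graph) (H : subgraph_family G) : Prop :=
  hyperbolic_graph (electrification G H) /\ bounded_penetration G H.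

Definition uniformly_hyperbolic (G : graph) (H : subgraph_family G) : Prop :=
  exists delta, 0 < delta /\
    forall c, delta_hyperbolic (point (member G H c)) (dist (member G H c)) delta.

(** * Hierarchies *)

(** Only [level i] for [1 <= i <= depth] and [family i], the family of
    subgraphs of [level (S i)], for [1 <= i < depth] are meaningful. *)
Record hierarchy (G : graph) := Hierarchy {
  depth : nat;
  level : nat -> graph;
  family : forall i, subgraph_family (level (S i));
  depth_pos : (1 <= depth)%nat;
  level_connected : forall i, (1 <= i <= depth)%nat -> connected (level i);
  level_hyperbolic :
    forall i, (1 <= i <= depth)%nat -> hyperbolic_graph (level i);
  level_top : level depth = G;
  family_hyperbolic : forall i, (1 <= i < depth)%nat ->
    uniformly_hyperbolic (level (S i)) (family i);
  level_relative : forall i, (1 <= i < depth)%nat ->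
    hyperbolic_relative_to (level (S i)) (family i);
  level_electrification : forall i, (1 <= i < depth)%nat ->
    isomorphic (level i) (electrification (level (S i)) (family i)) }.

Arguments depth {G} _.
Arguments level {G} _ _.
Arguments family {G} _ _.

Definition base (G : graph) (h : hierarchy G) : graph := level h 1.

Definition tame (G : graph) (h : hierarchy G) : Prop :=
  finite_asdim (point (base G h)) (dist (base G h)) /\
  forall i, (1 <= i < depth h)%nat -> exists n,
    uniform_asdim_le (index (family h i))
      (fun c => point (member (level h (S i)) (family h i) c))
      (fun c => dist (member (level h (S i)) (family h i) c)) n.

(* Main.v *)
From Stdlib Require Import Reals List ClassicalEpsilon Lra Lia Arith.
Require Import Defs.

(** In a [delta]-hyperbolic graph a single cover by bounded sets, of finite
    multiplicity at the one scale [4 * delta], already bounds the asymptotic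
    dimension: geodesic projection of annuli to smaller spheres contracts
    arbitrarily large scales to [4 * delta].  It is therefore enough to climb the
    hierarchy one level with a multiplicity that may depend on the scale.  A cover
    of the electrification [EG] pulls back to [G], where its members lie in
    electric balls of bounded radius.  Electric balls are covered by induction on
    the radius: passing from radius [n] to [n + 1] adds a neighbourhood of the
    smaller ball and the subgraphs [H_c] with [v_c] at distance at most [n] from
    the centre.  By bounded penetration, applied to paths of bounded length (which
    are quasi-geodesics for trivial reasons), each [H_c] is uniformly properly
    embedded, and distinct such [H_c] are far apart outside a neighbourhood of the
    smaller ball. *)

Lemma dependent_choice (S : Type) (T : S -> Type) (P : forall x, T x -> Prop) :
  (forall x, exists y, P x y) -> exists f, forall x, P x (f x).
Proof.
  intros H. exists (fun x => proj1_sig (constructive_indefinite_description _ (H x))).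
  intros x. apply proj2_sig.
Qed.

(** * Predicates with at most [n] solutions *)

(** The list may contain repetitions and elements outside [P], so only an upper bound on the number
    of solutions is recorded, without deciding [P] or equality. *)
Definition at_most {T : Type} (n : nat) (P : T -> Prop) : Prop :=
  exists l : list T, (length l <= n)%nat /\ forall a, P a -> In a l.

Lemma at_most_sub (T : Type) (n m : nat) (P Q : T -> Prop) :
  (n <= m)%nat -> (forall a, Q a -> P a) -> at_most n P -> at_most m Q.
Proof. intros Hnm HQP [l [Hl HP]]. exists l. split; [lia | auto]. Qed.

Lemma at_most_union (T : Type) (n m : nat) (P Q : T -> Prop) :
  at_most n P -> at_most m Q -> at_most (n + m) (fun a => P a \/ Q a).
Proof.
  intros [l [Hl HP]] [k [Hk HQ]]. exists (l ++ k). split.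
  - rewrite length_app. lia.
  - intros a [Ha | Ha]; apply in_or_app; auto.
Qed.

Lemma at_most_image (S T : Type) (f : S -> T) (n : nat) (P : S -> Prop) :
  at_most n P -> at_most n (fun b => exists a, P a /\ b = f a).
Proof.
  intros [l [Hl HP]]. exists (map f l). split.
  - now rewrite length_map.
  - intros b [a [Ha ->]]. apply in_map. auto.
Qed.

Lemma at_most_bind (S T : Type) (m n : nat) (P : S -> Prop) (Q : S -> T -> Prop) :
  at_most m P -> (forall a, P a -> at_most n (Q a)) ->
  at_most (m * n) (fun b => exists a, P a /\ Q a b).
Proof.
  intros [l [Hl HP]] HQ.
  assert (H : at_most (length l * n) (fun b => exists a, In a l /\ P a /\ Q a b)).
  { clear Hl HP. induction l as [| a l IH].
    - exists nil. split; [simpl; lia | intros b [a [[] _]]].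
    - apply at_most_sub with (n := (n + length l * n)%nat)
        (P := fun b => (P a /\ Q a b) \/ exists a, In a l /\ P a /\ Q a b).
      + simpl. lia.
      + intros b [a' [[<- | Hin] [HPa Hb]]]; [now left | right; eauto].
      + apply at_most_union; [| exact IH].
        (* An entry of the list outside [P] carries no bound on [Q a], but it contributes nothing to
           the union. *)
        destruct (classic (P a)) as [Ha | Ha].
        * apply at_most_sub with (n := n) (P := Q a); [lia | tauto | auto].
        * exists nil. split; [simpl; lia | tauto]. }
  revert H. apply at_most_sub.
  - apply Nat.mul_le_mono_r, Hl.
  - intros b [a [Ha Hb]]. eauto.
Qed.

(** * Covers of subsets at a given scale *)

(** Multiplicity is tested at every point of [X], not only of [Y], so that covers of different
    subsets can be added up. *)
Definition scale_cover (X : Type) (d : X -> X -> R) (Y : X -> Prop) (r D : R)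
  (n : nat) : Prop :=
  exists U, (forall x, Y x -> exists A, U A /\ A x) /\ bounded_by X d D U /\
    forall x, at_most n (fun A => U A /\ ball_meets X d r x A).

Lemma asdim_le_scale_cover (X : Type) (d : X -> X -> R) (n : nat) :
  asdim_le X d n <->
  forall r, 0 < r -> exists D, scale_cover X d (fun _ => True) r D (S n).
Proof.
  split; intros H r Hr; destruct (H r Hr) as [D HD].
  - destruct HD as [HU [[D' HD] Hm]]. exists D', D. repeat split; auto.
    intros x. destruct (Hm x) as [l [Hl Hin]]. exists l. split; [auto |].
    intros A [HA HxA]. auto.
  - destruct HD as [U [HU [HD Hm]]]. exists U. split; [intros x; auto |].
    split; [eauto |]. intros x. destruct (Hm x) as [l [Hl Hin]].
    exists l. split; [auto |]. intros A HA HxA. auto.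
Qed.

Lemma scale_cover_sub (X : Type) (d : X -> X -> R) (Y Y' : X -> Prop) (r D : R)
  (n : nat) :
  (forall x, Y' x -> Y x) -> scale_cover X d Y r D n -> scale_cover X d Y' r D n.
Proof. intros HY [U [HU HDm]]. exists U. auto. Qed.

Lemma scale_cover_union (X : Type) (d : X -> X -> R) (Y Y' : X -> Prop)
  (r D D' : R) (n n' : nat) :
  scale_cover X d Y r D n -> scale_cover X d Y' r D' n' ->
  scale_cover X d (fun x => Y x \/ Y' x) r (Rmax D D') (n + n').
Proof.
  intros [U [HU [HD Hm]]] [U' [HU' [HD' Hm']]].
  exists (fun A => U A \/ U' A). repeat split.
  - intros x [Hx | Hx]; [destruct (HU x Hx) as [A HA] | destruct (HU' x Hx) as [A HA]];
      exists A; tauto.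
  - intros A [HA | HA] x y Hx Hy.
    + eapply Rle_trans; [eapply HD; eauto | apply Rmax_l].
    + eapply Rle_trans; [eapply HD'; eauto | apply Rmax_r].
  - intros x. generalize (at_most_union _ _ _ _ _ (Hm x) (Hm' x)).
    apply at_most_sub; [lia | tauto].
Qed.

(** Take preimages under [f]: an [r]-ball maps into an [(r + a)]-ball, and diameters grow by at most
    [a]. *)
Lemma scale_cover_pullback (X Z : Type) (dX : X -> X -> R) (dZ : Z -> Z -> R)
  (f : X -> Z) (a r D : R) (n : nat) :
  (forall x y, dZ (f x) (f y) <= dX x y + a) ->
  (forall x y, dX x y <= dZ (f x) (f y) + a) ->
  scale_cover Z dZ (fun _ => True) (r + a) D n ->
  scale_cover X dX (fun _ => True) r (D + a) n.
Proof.
  intros Hf1 Hf2 [U [HU [HD Hm]]].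
  exists (fun B => exists A, U A /\ B = fun x => A (f x)). repeat split.
  - intros x _. destruct (HU (f x) I) as [A [HA HAx]].
    exists (fun x => A (f x)). eauto.
  - intros B [A [HA ->]] x y Hx Hy. pose proof (HD A HA _ _ Hx Hy).
    pose proof (Hf2 x y). lra.
  - intros x. generalize (at_most_image _ _ (fun A x => A (f x)) _ _ (Hm (f x))).
    apply at_most_sub; [lia |].
    intros B [[A [HA ->]] [y [Hy HAy]]]. exists A.
    split; [split; [exact HA |] | reflexivity].
    exists (f y). split; [| exact HAy]. pose proof (Hf1 x y). lra.
Qed.

Lemma asdim_le_pullback (X Z : Type) (dX : X -> X -> R) (dZ : Z -> Z -> R)
  (f : X -> Z) (a : R) (n : nat) :
  0 <= a ->
  (forall x y, dZ (f x) (f y) <= dX x y + a) ->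
  (forall x y, dX x y <= dZ (f x) (f y) + a) ->
  asdim_le Z dZ n -> asdim_le X dX n.
Proof.
  rewrite !asdim_le_scale_cover. intros Ha Hf1 Hf2 H r Hr.
  destruct (H (r + a)) as [D HD]; [lra |].
  exists (D + a). now apply scale_cover_pullback with (f := f) (dZ := dZ).
Qed.

(** * The vertex set with the combinatorial distance *)

Lemma adjacent_sym (G : graph) (u v : vertex G) :
  adjacent G u v -> adjacent G v u.
Proof. intros [e He]. exists e. tauto. Qed.

Lemma walk_app (G : graph) (n m : nat) (u v w : vertex G) :
  walk G n u v -> walk G m v w -> walk G (n + m) u w.
Proof.
  induction 1 as [u | n u v' v Huv Hvw IH]; simpl; [auto |].
  intros Hw. eapply walk_cons; eauto.
Qed.

Lemma walk_one (G : graph) (u v : vertex G) : adjacent G u v -> walk G 1 u v.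
Proof. intros H. eapply walk_cons; [exact H | apply walk_nil]. Qed.

Lemma walk_sym (G : graph) (n : nat) (u v : vertex G) :
  walk G n u v -> walk G n v u.
Proof.
  induction 1 as [u | n u v w Huv Hvw IH]; [apply walk_nil |].
  rewrite <- Nat.add_1_r. eapply walk_app; [exact IH |].
  now apply walk_one, adjacent_sym.
Qed.

Lemma walk_map (G G' : graph) (f : vertex G -> vertex G') :
  (forall u v, adjacent G u v -> adjacent G' (f u) (f v)) ->
  forall n u v, walk G n u v -> walk G' n (f u) (f v).
Proof.
  intros Hf n u v. induction 1 as [u | n u v w Huv Hvw IH]; [apply walk_nil |].
  eapply walk_cons; eauto.
Qed.

Lemma walk_path (G : graph) (n : nat) (u v : vertex G) :
  walk G n u v ->
  exists g, g 0%nat = u /\ g n = v /\ simplicial_path G n g.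
Proof.
  induction 1 as [u | n u v w Huv Hvw [g [H0 [Hn Hg]]]].
  - exists (fun _ => u). repeat split. intros i Hi. lia.
  - exists (fun i => match i with 0%nat => u | S j => g j end).
    repeat split; [exact Hn |]. intros [| i] Hi.
    + now rewrite H0.
    + apply Hg. lia.
Qed.

Lemma path_walk (G : graph) (n : nat) (g : nat -> vertex G) (i j : nat) :
  simplicial_path G n g -> (i <= j <= n)%nat -> walk G (j - i) (g i) (g j).
Proof.
  intros Hg Hij.
  assert (H : forall k i, (i + k <= n)%nat -> walk G k (g i) (g (i + k)%nat)).
  { induction k as [| k IH]; intros a Ha.
    - rewrite Nat.add_0_r. apply walk_nil.
    - eapply walk_cons; [apply Hg; lia |].
      replace (a + S k)%nat with (S a + k)%nat by lia. apply IH. lia. }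
  generalize (H (j - i)%nat i). replace (i + (j - i))%nat with j by lia.
  intros H'. apply H'. lia.
Qed.

Section VertexMetric.
Variables (G : graph) (Gconn : connected G).

Lemma vdist_spec (u v : vertex G) :
  walk G (vdist G u v) u v /\ forall m, walk G m u v -> (vdist G u v <= m)%nat.
Proof.
  unfold vdist. apply epsilon_spec.
  destruct (proj2 Gconn u v) as [n Hn]. revert Hn.
  induction n as [n IH] using (well_founded_induction lt_wf). intros Hn.
  destruct (classic (exists m, (m < n)%nat /\ walk G m u v)) as [[m [Hm Hw]] | H].
  - eauto.
  - exists n. split; [exact Hn |]. intros m Hm.
    destruct (Nat.le_gt_cases n m) as [Hle | Hlt]; [exact Hle |].
    exfalso. eauto.
Qed.

Lemma vdist_walk (u v : vertex G) : walk G (vdist G u v) u v.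
Proof. apply vdist_spec. Qed.

Lemma vdist_le (n : nat) (u v : vertex G) :
  walk G n u v -> (vdist G u v <= n)%nat.
Proof. apply vdist_spec. Qed.

Lemma vdist_refl (u : vertex G) : vdist G u u = 0%nat.
Proof. pose proof (vdist_le 0 u u (walk_nil G u)). lia. Qed.

Lemma vdist_sym (u v : vertex G) : vdist G u v = vdist G v u.
Proof.
  apply Nat.le_antisymm; apply vdist_le, walk_sym, vdist_walk.
Qed.

Lemma vdist_triangle (u v w : vertex G) :
  (vdist G u w <= vdist G u v + vdist G v w)%nat.
Proof. apply vdist_le. eapply walk_app; apply vdist_walk. Qed.

Lemma vdist_eq0 (u v : vertex G) : vdist G u v = 0%nat -> u = v.
Proof.
  intros H. generalize (vdist_walk u v). rewrite H. now inversion 1.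
Qed.

Lemma vdist_adjacent (u v : vertex G) :
  adjacent G u v -> (vdist G u v <= 1)%nat.
Proof. intros H. now apply vdist_le, walk_one. Qed.

(** The two pieces of a shortest walk bound the distances from [g i] to its ends, and the triangle
    inequality turns these bounds into equalities. *)
Lemma geodesic_path (u v : vertex G) :
  exists g, g 0%nat = u /\ g (vdist G u v) = v /\
    simplicial_path G (vdist G u v) g /\
    forall i, (i <= vdist G u v)%nat -> vdist G u (g i) = i.
Proof.
  destruct (walk_path G _ u v (vdist_walk u v)) as [g [H0 [Hn Hg]]].
  exists g. repeat split; auto. intros i Hi.
  pose proof (path_walk G _ g 0 i Hg ltac:(lia)) as H1.
  pose proof (path_walk G _ g i _ Hg ltac:(split; [exact Hi | apply le_n])) as H2.
  rewrite H0 in H1. rewrite Hn in H2.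
  apply vdist_le in H1, H2. pose proof (vdist_triangle u (g i) v). lia.
Qed.

(** * Comparison of the metric graph with its vertex set *)

Definition vmetric (u v : vertex G) : R := INR (vdist G u v).

Lemma vmetric_refl (u : vertex G) : vmetric u u = 0.
Proof. unfold vmetric. now rewrite vdist_refl. Qed.

Lemma vmetric_sym (u v : vertex G) : vmetric u v = vmetric v u.
Proof. unfold vmetric. now rewrite vdist_sym. Qed.

Lemma vmetric_triangle (u v w : vertex G) :
  vmetric u w <= vmetric u v + vmetric v w.
Proof.
  unfold vmetric. rewrite <- plus_INR. apply le_INR, vdist_triangle.
Qed.

Definition end_vertex (p : point G) : vertex G :=
  match p with Vert v => v | Inner e _ _ => src G e end.

Lemma vmetric_edge (e : edge G) (v : vertex G) :
  vmetric (src G e) v - 1 <= vmetric (tgt G e) v <= vmetric (src G e) v + 1.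
Proof.
  assert (H : vmetric (src G e) (tgt G e) <= 1).
  { apply (le_INR _ 1), vdist_adjacent. exists e. now left. }
  pose proof (vmetric_triangle (src G e) (tgt G e) v).
  pose proof (vmetric_triangle (tgt G e) (src G e) v).
  rewrite (vmetric_sym (tgt G e) (src G e)) in *. lra.
Qed.

Lemma dist_to_vertex_end_vertex (p : point G) (v : vertex G) :
  vmetric (end_vertex p) v - 1 <= dist_to_vertex G p v
    <= vmetric (end_vertex p) v + 1.
Proof.
  destruct p as [u | e t t01]; simpl.
  - unfold vmetric. lra.
  - pose proof (vmetric_edge e v). unfold vmetric in *.
    unfold Rmin. destruct Rle_dec; lra.
Qed.

Lemma dist_end_vertex (p q : point G) :
  vmetric (end_vertex p) (end_vertex q) <= dist G p q + 2 /\
  dist G p q <= vmetric (end_vertex p) (end_vertex q) + 2.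
Proof.
  destruct q as [v | f s s01]; simpl.
  - pose proof (dist_to_vertex_end_vertex p v). lra.
  - assert (H : vmetric (end_vertex p) (src G f) - 2 <=
      Rmin (s + dist_to_vertex G p (src G f)) (1 - s + dist_to_vertex G p (tgt G f))
      <= vmetric (end_vertex p) (src G f) + 2).
    { pose proof (dist_to_vertex_end_vertex p (src G f)).
      pose proof (dist_to_vertex_end_vertex p (tgt G f)).
      pose proof (vmetric_edge f (end_vertex p)).
      rewrite (vmetric_sym (src G f)), (vmetric_sym (tgt G f)) in *.
      unfold Rmin. destruct Rle_dec; lra. }
    destruct p as [u | e t t01]; [lra |].
    (* On a common edge the end vertices coincide, and both candidates for the distance have
       absolute value at most 2. *)
    destruct excluded_middle_informative as [<- | _]; [| lra].
    cbn [end_vertex] in *. rewrite vmetric_refl in *.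
    revert H. generalize (Rmin (s + dist_to_vertex G (Inner e t t01) (src G e))
      (1 - s + dist_to_vertex G (Inner e t t01) (tgt G e))).
    intros a Ha. unfold Rmin, Rabs. destruct Rcase_abs, Rle_dec; lra.
Qed.

Lemma asdim_le_vertices (n : nat) :
  asdim_le (point G) (dist G) n <-> asdim_le (vertex G) vmetric n.
Proof.
  split.
  - apply asdim_le_pullback with (f := @Vert G) (a := 0); [lra | |];
      intros u v; unfold vmetric; simpl; lra.
  - apply asdim_le_pullback with (f := end_vertex) (a := 2); [lra | |];
      intros p q; apply dist_end_vertex.
Qed.

Definition thickening (K : R) (Y : vertex G -> Prop) (x : vertex G) : Prop :=
  exists y, Y y /\ vmetric x y <= K.

(** Thicken every member of the cover: an [r]-ball that meets the thickening of [A] yields an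
    [(r + K)]-ball that meets [A]. *)
Lemma scale_cover_thickening (K : R) (Y : vertex G -> Prop) (r D : R) (n : nat) :
  scale_cover (vertex G) vmetric Y (r + K) D n ->
  scale_cover (vertex G) vmetric (thickening K Y) r (D + 2 * K) n.
Proof.
  intros [U [HU [HD Hm]]].
  exists (fun B => exists A, U A /\ B = thickening K A). repeat split.
  - intros x [y [Hy Hxy]]. destruct (HU y Hy) as [A [HA HAy]].
    exists (thickening K A). split; [eauto |]. exists y. auto.
  - intros B [A [HA ->]] x y [x' [Hx' Hx]] [y' [Hy' Hy]].
    pose proof (HD A HA x' y' Hx' Hy'). pose proof (vmetric_triangle x x' y).
    pose proof (vmetric_triangle x' y' y). rewrite (vmetric_sym y' y) in *. lra.
  - intros x. generalize (at_most_image _ _ (thickening K) _ _ (Hm x)).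
    apply at_most_sub; [lia |].
    intros B [[A [HA ->]] [y [Hxy [z [Hz Hyz]]]]]. exists A.
    split; [split; [exact HA |] | reflexivity].
    exists z. split; [| exact Hz]. pose proof (vmetric_triangle x y z). lra.
Qed.

(** * Hyperbolic graphs: one scale suffices *)

Lemma geodesic_interpolation (u v : vertex G) (k : nat) :
  (k <= vdist G u v)%nat ->
  exists w, vdist G u w = k /\ (vdist G w v <= vdist G u v - k)%nat.
Proof.
  intros Hk. destruct (geodesic_path u v) as [g [H0 [Hn [Hg Hd]]]].
  exists (g k). split; [auto |]. apply vdist_le.
  rewrite <- Hn at 2. apply path_walk with (1 := Hg). lia.
Qed.

(** Based at [o], the Gromov products of [s, x], of [x, y] and of [y, t] are all at least [m]. Two
    uses of hyperbolicity give at least [m - 2 * delta] for [s, t], and [s] and [t] both lie at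
    distance [m] from [o]. *)
Lemma geodesics_fellow_travel (delta m : R) (o x y s t : vertex G) :
  0 <= delta -> delta_hyperbolic (vertex G) vmetric delta ->
  vmetric o s = m -> vmetric s x <= vmetric o x - m ->
  vmetric o t = m -> vmetric t y <= vmetric o y - m ->
  2 * m <= vmetric o x + vmetric o y - vmetric x y ->
  vmetric s t <= 4 * delta.
Proof.
  intros Hdelta Hyp Hs Hsx Ht Hty Hxy.
  pose proof (Hyp o s x y) as H1. pose proof (Hyp o s y t) as H2.
  unfold gromov_product in *.
  rewrite (vmetric_sym s o), (vmetric_sym t o), (vmetric_sym x o),
    (vmetric_sym y o), (vmetric_sym y t) in *.
  unfold Rmin in *. repeat destruct Rle_dec; lra.
Qed.

(* Cut [G] into annuli of width [R] around [o] and push the annulus of index [k]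
   along geodesics to the sphere of radius [(k - 1) R]: this moves points at most
   [2 R], and points of one annulus at distance at most [R] become
   [4 delta]-close, whatever [R] is. *)
Lemma hyperbolic_asdim_le (delta D : R) (n : nat) :
  0 <= delta -> delta_hyperbolic (vertex G) vmetric delta ->
  scale_cover (vertex G) vmetric (fun _ => True) (4 * delta) D n ->
  asdim_le (vertex G) vmetric (3 * n).
Proof.
  intros Hdelta Hyp [U [HU [HD Hm]]]. apply asdim_le_scale_cover. intros r Hr.
  destruct Gconn as [[o] _].
  (* With [w > 2 * r], any two points of one [r]-ball are at distance at most [w], and the ball
     meets at most three annuli. *)
  destruct (INR_unbounded (2 * r)) as [w Hw].
  assert (Hw0 : (0 < w)%nat) by (apply INR_lt; simpl; lra).
  set (annulus := fun x => (vdist G o x / w)%nat).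
  (* By truncated subtraction the annuli 0 and 1 are both pushed to [o] itself. *)
  set (m := fun x => ((annulus x - 1) * w)%nat).
  assert (Hdiv : forall x, (annulus x * w <= vdist G o x < annulus x * w + w)%nat).
  { intros x. unfold annulus.
    pose proof (Nat.div_mod_eq (vdist G o x) w).
    pose proof (Nat.mod_upper_bound (vdist G o x) w). lia. }
  destruct (dependent_choice _ (fun _ => vertex G)
    (fun x s => vdist G o s = m x /\ (vdist G s x <= vdist G o x - m x)%nat))
    as [push Hpush].
  { intros x. apply geodesic_interpolation. pose proof (Hdiv x). unfold m. nia. }
  assert (Hclose : forall x, vmetric (push x) x <= 2 * INR w).
  { intros x. apply Rle_trans with (INR (2 * w)).
    - apply le_INR. pose proof (Hdiv x). pose proof (Hpush x). unfold m in *.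
      destruct (annulus x) as [| k]; simpl in *; nia.
    - rewrite mult_INR. simpl. lra. }
  assert (Hcontr : forall x y, annulus x = annulus y -> vmetric x y <= INR w ->
    vmetric (push x) (push y) <= 4 * delta).
  { intros x y Hk Hxy. destruct (Hpush x) as [Hx1 Hx2], (Hpush y) as [Hy1 Hy2].
    assert (Hmx : (m x <= vdist G o x)%nat) by (pose proof (Hdiv x); unfold m; nia).
    assert (Hmy : (m y <= vdist G o y)%nat) by (pose proof (Hdiv y); unfold m; nia).
    assert (Hmxy : m y = m x) by (unfold m; now rewrite Hk).
    apply geodesics_fellow_travel with (m := INR (m x)) (o := o) (x := x) (y := y);
      auto; unfold vmetric.
    - now rewrite Hx1.
    - rewrite <- minus_INR by exact Hmx. now apply le_INR.
    - now rewrite Hy1, Hmxy.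
    - rewrite <- Hmxy, <- minus_INR by exact Hmy. now apply le_INR.
    - fold (vmetric o x) (vmetric o y) (vmetric x y).
      (* In annulus 0 the sphere is the point [o] and the triangle inequality suffices; otherwise
         [x] and [y] lie at least [w] beyond the sphere, which compensates for their distance. *)
      destruct (Nat.eq_dec (annulus x) 0) as [H0 | H0].
      + replace (m x) with 0%nat by (unfold m; rewrite H0; reflexivity).
        pose proof (vmetric_triangle x o y). rewrite (vmetric_sym x o) in *.
        simpl. lra.
      + assert (H : (m x + w <= vdist G o x)%nat /\ (m x + w <= vdist G o y)%nat).
        { pose proof (Hdiv x). pose proof (Hdiv y). unfold m. rewrite Hk in *.
          destruct (annulus y) as [| k]; [lia |]. simpl in *.
          rewrite Nat.sub_0_r. lia. }
        destruct H as [H1 H2]. apply le_INR in H1, H2.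
        rewrite plus_INR in H1, H2. unfold vmetric in *. lra. }
  exists (D + 4 * INR w).
  exists (fun B => exists k A, U A /\ B = fun x => annulus x = k /\ A (push x)).
  repeat split.
  - intros x _. destruct (HU (push x) I) as [A [HA HAx]].
    exists (fun y => annulus y = annulus x /\ A (push y)). split; [| auto].
    exists (annulus x), A. auto.
  - intros B [k [A [HA ->]]] x y [_ Hx] [_ Hy].
    pose proof (HD A HA _ _ Hx Hy). pose proof (Hclose x). pose proof (Hclose y).
    pose proof (vmetric_triangle x (push x) y).
    pose proof (vmetric_triangle (push x) (push y) y).
    rewrite (vmetric_sym x (push x)) in *. lra.
  - intros x.
    assert (Hk : at_most 3 (fun k => k = (annulus x - 1)%nat \/ k = annulus x \/
      k = (annulus x + 1)%nat)).
    { exists ((annulus x - 1)%nat :: annulus x :: (annulus x + 1)%nat :: nil).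
      split; [simpl; lia |]. intros k H. simpl. intuition. }
    pose (Q := fun k B => exists A, (U A /\ exists y, vmetric x y <= r /\
      annulus y = k /\ A (push y)) /\ B = fun y => annulus y = k /\ A (push y)).
    assert (HQ : forall k, at_most n (Q k)).
    { intros k. apply at_most_image.
      (* Recentre at a point [y0] of annulus [k] in the ball: the whole part of the ball in that
         annulus is pushed into the [4 * delta]-ball around [push y0]. *)
      destruct (classic (exists y, vmetric x y <= r /\ annulus y = k))
        as [[y0 [Hy0 Hky0]] | Hno].
      - generalize (Hm (push y0)). apply at_most_sub; [lia |].
        intros A [HA [y [Hy [Hky HAy]]]]. split; [exact HA |].
        exists (push y). split; [| exact HAy]. apply Hcontr; [congruence |].
        pose proof (vmetric_triangle y0 x y). rewrite (vmetric_sym y0 x) in *. lra.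
      - exists nil. split; [simpl; lia |].
        intros A [_ [y [Hy [Hky _]]]]. exfalso. eauto. }
    generalize (at_most_bind _ _ _ _ _ _ Hk (fun k _ => HQ k)).
    apply at_most_sub; [lia |].
    intros B [[k [A [HA ->]]] [y [Hy [Hky HAy]]]]. exists k. split.
    + assert (Hxy : (vdist G x y <= w)%nat).
      { apply INR_le. unfold vmetric in Hy. lra. }
      pose proof (vdist_triangle o x y). pose proof (vdist_triangle o y x).
      rewrite (vdist_sym y x) in *.
      pose proof (Hdiv x). pose proof (Hdiv y). rewrite Hky in *.
      assert (k < annulus x + 2)%nat by nia.
      assert (annulus x < k + 2)%nat by nia. lia.
    + exists A. split; [split; [exact HA | eauto] | reflexivity].
Qed.

End VertexMetric.

(** * Electrification *)

Section Electrification.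
Variables (G : graph) (Gconn : connected G) (H : subgraph_family G).

Local Notation EG := (electrification G H).
Local Notation cone c := (inr c : vertex EG).
Local Notation plain x := (inl x : vertex EG).

Lemma adjacent_plain (u v : vertex G) :
  adjacent EG (plain u) (plain v) <-> adjacent G u v.
Proof.
  split.
  - intros [[e | [c x]] He]; simpl in He.
    + exists e. destruct He as [[H1 H2] | [H1 H2]]; [left | right];
        split; congruence.
    + destruct He as [[_ He] | [_ He]]; discriminate.
  - intros [e He]. exists (inl e). simpl.
    destruct He as [[-> ->] | [-> ->]]; auto.
Qed.

Lemma adjacent_cone (u : vertex G) (c : index H) :
  adjacent EG (plain u) (cone c) <-> member_vertices H c u.
Proof.
  split.
  - intros [[e | [c' x]] He]; simpl in He.
    + destruct He as [[_ He] | [He _]]; discriminate.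
    + destruct He as [[H1 H2] | [H1 H2]]; [| discriminate].
      injection H1 as <-. injection H2 as <-. exact (proj2_sig x).
  - intros Hu. exists (inr (existT _ c (exist _ u Hu))). now left.
Qed.

Lemma not_adjacent_cones (c c' : index H) : ~ adjacent EG (cone c) (cone c').
Proof.
  intros [[e | [c'' x]] He]; simpl in He; destruct He as [[H1 H2] | [H1 H2]];
    discriminate.
Qed.

Lemma member_is_connected (c : index H) : connected (member G H c).
Proof. exact (member_connected G H c). Qed.

(** Each cone vertex is joined to [G] because [connected] makes every member nonempty. *)
Lemma electrification_connected : connected EG.
Proof.
  assert (Hp : forall u v, exists n, walk EG n (plain u) (plain v)).
  { intros u v. destruct (proj2 Gconn u v) as [n Hn]. exists n. revert Hn.
    apply walk_map with (f := fun x => plain x). intros x y. apply adjacent_plain. }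
  assert (Hc : forall a : vertex EG, exists u n, walk EG n a (plain u)).
  { intros [u | c]; [exists u, 0%nat; apply walk_nil |].
    destruct (member_is_connected c) as [[[u Hu]] _].
    exists u, 1%nat. apply walk_one, adjacent_sym, adjacent_cone, Hu. }
  split.
  - destruct Gconn as [[u] _]. exact (inhabits (plain u)).
  - intros a b. destruct (Hc a) as [u [n Hn]], (Hc b) as [v [m Hm]].
    destruct (Hp u v) as [k Hk]. exists (n + (k + m))%nat.
    eapply walk_app; [exact Hn |]. eapply walk_app; [exact Hk |].
    now apply walk_sym.
Qed.

Lemma vdist_plain_le (u v : vertex G) :
  (vdist EG (plain u) (plain v) <= vdist G u v)%nat.
Proof.
  apply vdist_le; [apply electrification_connected |].
  generalize (vdist_walk G Gconn u v).
  apply walk_map with (f := fun x => plain x). intros x y. apply adjacent_plain.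
Qed.

Lemma vdist_member_ge (c : index H) (x y : vertex (member G H c)) :
  vmetric G (proj1_sig x) (proj1_sig y) <= vmetric (member G H c) x y.
Proof.
  apply le_INR, vdist_le; [exact Gconn |].
  generalize (vdist_walk _ (member_is_connected c) x y).
  apply walk_map with (f := @proj1_sig _ _). intros u v [e He].
  exists (proj1_sig e). simpl in He.
  destruct He as [[<- <-] | [<- <-]]; auto.
Qed.

(* The additive error [L] absorbs the whole length. *)
Lemma short_path_quasi_geodesic (L : R) (n : nat) (g : nat -> vertex EG) :
  1 < L -> INR n <= L -> simplicial_path EG n g -> quasi_geodesic EG L n g.
Proof.
  intros HL Hn Hg i j Hij.
  assert (H1 : INR (j - i) <= INR n) by (apply le_INR; lia).
  assert (H2 : INR (vdist EG (g i) (g j)) <= INR (j - i)).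
  { apply le_INR, vdist_le; [apply electrification_connected |].
    apply path_walk with (1 := Hg). exact Hij. }
  pose proof (pos_INR (j - i)). pose proof (pos_INR (vdist EG (g i) (g j))).
  assert (HdivL : INR (j - i) / L <= L).
  { apply Rmult_le_reg_r with L; [lra |]. unfold Rdiv.
    rewrite Rmult_assoc, Rinv_l by lra. nra. }
  split; [lra | nra].
Qed.

(** * Paths that reach a cone vertex and continue inside [G] *)

Definition detour (m : nat) (g : nat -> vertex EG) (q : nat -> vertex G)
  (i : nat) : vertex EG :=
  if (i <=? m)%nat then g i else plain (q (i - S m)%nat).

Lemma detour_le (m : nat) (g : nat -> vertex EG) (q : nat -> vertex G) (i : nat) :
  (i <= m)%nat -> detour m g q i = g i.
Proof. unfold detour. destruct (Nat.leb_spec i m); [auto | lia]. Qed.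

Lemma detour_gt (m : nat) (g : nat -> vertex EG) (q : nat -> vertex G) (i : nat) :
  detour m g q (S m + i) = plain (q i).
Proof.
  unfold detour. destruct (Nat.leb_spec (S m + i) m); [lia |].
  now replace (S m + i - S m)%nat with i by lia.
Qed.

(** Efficiency holds because the geodesic part visits no vertex twice and the part after it stays in
    [G]; the quasi-geodesic inequality comes from the bounded length. *)
Lemma detour_efficient_quasi_geodesic (L : R) (c : index H) (m n : nat)
  (g : nat -> vertex EG) (q : nat -> vertex G) :
  1 < L -> INR (S m + n) <= L -> simplicial_path EG m g ->
  (forall i, (i <= m)%nat -> vdist EG (g 0%nat) (g i) = i) -> g m = cone c ->
  member_vertices H c (q 0%nat) -> simplicial_path G n q ->
  efficient_quasi_geodesic G H L (S m + n) (detour m g q).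
Proof.
  intros HL Hlen Hg Hgeo Hgm Hq0 Hq.
  assert (Hpath : simplicial_path EG (S m + n) (detour m g q)).
  { intros i Hi. destruct (Nat.lt_trichotomy i m) as [Hlt | [-> | Hgt]].
    - rewrite !detour_le by lia. now apply Hg.
    - rewrite detour_le, Hgm by lia.
      replace (S m) with (S m + 0)%nat by lia. rewrite detour_gt.
      now apply adjacent_sym, adjacent_cone.
    - replace i with (S m + (i - S m))%nat by lia.
      rewrite <- Nat.add_succ_r, !detour_gt. apply adjacent_plain, Hq. lia. }
  split; [exact Hpath |]. split; [now apply short_path_quasi_geodesic |].
  assert (Hbound : forall c' i, detour m g q i = cone c' ->
    (i <= m)%nat /\ g i = cone c').
  { intros c' i. unfold detour.
    destruct (Nat.leb_spec i m); [auto | discriminate]. }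
  intros c' i j _ _ Hi Hj. apply Hbound in Hi, Hj.
  destruct Hi as [Hi1 Hi2], Hj as [Hj1 Hj2].
  rewrite <- (Hgeo i Hi1), <- (Hgeo j Hj1). congruence.
Qed.

(** Cone vertices are never adjacent to each other, so the last vertex before [v_c] lies in [H_c]:
    it is the entry point to which bounded penetration applies. *)
Lemma geodesic_to_cone (v : vertex G) (c : index H) :
  exists (k : nat) (g : nat -> vertex EG) (y : vertex (member G H c)),
    vdist EG (plain v) (cone c) = S k /\ g 0%nat = plain v /\
    g k = plain (proj1_sig y) /\ g (S k) = cone c /\ simplicial_path EG (S k) g /\
    forall i, (i <= S k)%nat -> vdist EG (plain v) (g i) = i.
Proof.
  destruct (geodesic_path EG electrification_connected (plain v) (cone c))
    as [g [H0 [Hn [Hg Hd]]]].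
  destruct (vdist EG (plain v) (cone c)) as [| k] eqn:Hk; [congruence |].
  pose proof (Hg k (Nat.lt_succ_diag_r k)) as Hadj. rewrite Hn in Hadj.
  destruct (g k) as [y | c'] eqn:Hgk; [| now apply not_adjacent_cones in Hadj].
  apply adjacent_cone in Hadj.
  exists k, g, (exist _ y Hadj). repeat split; auto.
Qed.

(** * Consequences of bounded penetration *)

Section BoundedPenetration.
Hypothesis Hpen : bounded_penetration G H.

(* Compare the path [x, v_c, y] with a geodesic of [G], which avoids [v_c]. *)
Lemma members_properly_embedded (r : R) :
  exists rho, 0 < rho /\ forall (c : index H) (x y : vertex (member G H c)),
    vmetric G (proj1_sig x) (proj1_sig y) <= r -> vmetric (member G H c) x y <= rho.
Proof.
  pose proof (Rabs_pos r) as Hr0. pose proof (Rle_abs r) as Hr1.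
  (* This constant exceeds the length 2 of the path through [v_c] and the length, at most [r], of
     the geodesic; the absolute value allows for a negative [r]. *)
  destruct (Hpen (Rabs r + 3)) as [p [Hp Hpp]]; [lra |].
  exists p. split; [exact Hp |]. intros c x y Hxy.
  destruct (Rle_or_lt (vmetric (member G H c) x y) p) as [Hle | Hlt]; [exact Hle |].
  exfalso.
  destruct (geodesic_path G Gconn (proj1_sig x) (proj1_sig y))
    as [q [Hq0 [Hqn [Hq _]]]].
  pose (g := fun i : nat => match i with 0%nat => plain (proj1_sig x)
                            | _ => cone c end).
  assert (Hxc : adjacent EG (plain (proj1_sig x)) (cone c))
    by apply adjacent_cone, (proj2_sig x).
  assert (Hgam : efficient_quasi_geodesic G H (Rabs r + 3) (2 + 0)
    (detour 1 g (fun _ => proj1_sig y))).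
  { apply detour_efficient_quasi_geodesic with (c := c).
    - lra.
    - simpl. lra.
    - intros [| i] Hi; [exact Hxc | lia].
    - intros [| [| i]] Hi; [| | lia]; simpl.
      + apply vdist_refl, electrification_connected.
      + pose proof (vdist_adjacent _ electrification_connected _ _ Hxc).
        destruct (vdist EG (plain (proj1_sig x)) (cone c)) as [| [| k]] eqn:E;
          [| reflexivity | lia].
        apply vdist_eq0 in E; [discriminate | apply electrification_connected].
    - reflexivity.
    - exact (proj2_sig y).
    - intros i Hi. lia. }
  destruct (Hpp _ _ (vdist G (proj1_sig x) (proj1_sig y)) (fun i => plain (q i))
    Hgam) with (c := c) (k := 0%nat) (x := x) (y := y) as [[i [_ Hi]] _].
  - assert (Hpath : simplicial_path EG (vdist G (proj1_sig x) (proj1_sig y))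
      (fun i => plain (q i))).
    { intros i Hi. apply adjacent_plain, Hq, Hi. }
    split; [exact Hpath |]. split.
    + apply short_path_quasi_geodesic; [lra | unfold vmetric in Hxy; lra | auto].
    + intros c' i j _ _ Hi. discriminate.
  - now rewrite Hq0.
  - now rewrite Hqn.
  - repeat split; auto.
  - apply Rlt_le, Hlt.
  - discriminate.
Qed.

Definition electric_ball (n : nat) (v x : vertex G) : Prop :=
  (vdist EG (plain v) (plain x) <= n)%nat.

(* If [v_c] is not closer to [v] than [v_c'], a path from [v] to [x] through
   [v_c'] and [x'] avoids [v_c]. *)
Lemma close_members_near_ball (n : nat) (r : R) :
  exists K, 0 < K /\ forall (v x x' : vertex G) (c c' : index H),
    c <> c' -> (vdist EG (plain v) (cone c) <= n)%nat ->
    (vdist EG (plain v) (cone c') <= vdist EG (plain v) (cone c))%nat ->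
    member_vertices H c x -> member_vertices H c' x' -> vmetric G x x' <= r ->
    thickening G K (electric_ball n v) x.
Proof.
  pose proof (Rabs_pos r) as Hr0. pose proof (Rle_abs r) as Hr1. pose proof (pos_INR n) as Hn0.
  (* Both paths compared below have length at most [n + 1 + Rabs r]. *)
  destruct (Hpen (INR n + Rabs r + 2)) as [p [Hp Hpp]]; [lra |].
  exists p. split; [exact Hp |].
  intros v x x' c c' Hcc' Hc Hcc Hx Hx' Hxx'.
  destruct (geodesic_to_cone v c) as [k [g [y [Hk [H0 [Hy [Hgc [Hg Hd]]]]]]]].
  destruct (geodesic_to_cone v c')
    as [k' [g' [y' [Hk' [H0' [Hy' [Hgc' [Hg' Hd']]]]]]]].
  set (hx := exist _ x Hx : vertex (member G H c)).
  exists (proj1_sig y). split.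
  { unfold electric_ball. rewrite <- Hy, Hd by lia. lia. }
  (* If [x] were farther than [p] from the entry point [y] in [G], it would be so in [H_c] too, and
     the path through [v_c'] would have to visit [v_c]. *)
  destruct (Rle_or_lt (vmetric G x (proj1_sig y)) p) as [Hle | Hlt]; [exact Hle |].
  exfalso.
  destruct (geodesic_path G Gconn x' x) as [q [Hq0 [Hqn [Hq _]]]].
  assert (Hx'x : INR (vdist G x' x) <= r) by (rewrite vdist_sym; auto).
  assert (Hgam : efficient_quasi_geodesic G H (INR n + Rabs r + 2) (S (S k) + 0)
    (detour (S k) g (fun _ => x))).
  { apply detour_efficient_quasi_geodesic with (c := c); auto.
    - lra.
    - rewrite Hk in Hc. apply le_INR in Hc. rewrite Nat.add_0_r, S_INR. lra.
    - intros i Hi. rewrite H0. auto.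
    - intros i Hi. lia. }
  assert (Hgam' : efficient_quasi_geodesic G H (INR n + Rabs r + 2)
    (S (S k') + vdist G x' x) (detour (S k') g' q)).
  { apply detour_efficient_quasi_geodesic with (c := c'); auto.
    - lra.
    - rewrite Hk in Hc. rewrite Hk', Hk in Hcc.
      pose proof (le_INR (S k') n ltac:(lia)). rewrite plus_INR, S_INR. lra.
    - intros i Hi. rewrite H0'. auto.
    - now rewrite Hq0. }
  destruct (Hpp _ _ _ _ Hgam Hgam') with (c := c) (k := k) (x := y) (y := hx)
    as [[i [_ Hi]] _].
  - rewrite !detour_le by lia. congruence.
  - rewrite !detour_gt. now rewrite Hqn.
  - split; [lia |]. rewrite (detour_le _ _ _ k), (detour_le _ _ _ (S k)) by lia.
    split; [exact Hy |]. split; [exact Hgc |].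
    replace (S (S k)) with (S (S k) + 0)%nat by lia. apply detour_gt.
  - pose proof (vdist_member_ge c y hx) as Hyx. simpl in Hyx.
    rewrite vmetric_sym in Hyx by exact Gconn. unfold vmetric in *. lra.
  - unfold detour in Hi. destruct (Nat.leb_spec i (S k')) as [Hle | _];
      [| discriminate].
    pose proof (Hd' i Hle) as Hdi. rewrite Hi, Hk in Hdi.
    assert (i = S k') as -> by lia. rewrite Hgc' in Hi. congruence.
Qed.

(** Apply the preceding lemma to whichever cone vertex is not closer to [v]. Taking [K >= 1] lets
    the excluded neighbourhood absorb the 1-neighbourhood in [electric_ball_step]. *)
Lemma members_separated (n : nat) (r : R) :
  exists K, 1 <= K /\ forall (v x x' : vertex G) (c c' : index H),
    (vdist EG (plain v) (cone c) <= n)%nat ->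
    (vdist EG (plain v) (cone c') <= n)%nat ->
    member_vertices H c x -> member_vertices H c' x' -> vmetric G x x' <= r ->
    ~ thickening G K (electric_ball n v) x ->
    ~ thickening G K (electric_ball n v) x' -> c = c'.
Proof.
  destruct (close_members_near_ball n r) as [K [HK Hnear]].
  exists (Rmax K 1). split; [apply Rmax_r |].
  assert (Hmono : forall Y x, thickening G K Y x -> thickening G (Rmax K 1) Y x).
  { intros Y x [y [Hy Hxy]]. exists y. split; [exact Hy |].
    eapply Rle_trans; [exact Hxy | apply Rmax_l]. }
  intros v x x' c c' Hc Hc' Hx Hx' Hxx' Hnx Hnx'.
  apply NNPP. intros Hcc'.
  destruct (Nat.le_ge_cases (vdist EG (plain v) (cone c'))
    (vdist EG (plain v) (cone c))) as [Hle | Hle].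
  - apply Hnx, Hmono, Hnear with (x' := x') (c := c) (c' := c'); auto.
  - apply Hnx', Hmono, Hnear with (x' := x) (c := c') (c' := c); auto.
    now rewrite vmetric_sym.
Qed.

(** * Covers of electric balls, uniform in the centre *)

Variable mult : nat.
Hypothesis Hmembers : forall r, 0 < r -> exists D, forall c,
  scale_cover (vertex (member G H c)) (vmetric (member G H c))
    (fun _ => True) r D mult.

(** The two cases are whether the last vertex before [x] on an electric geodesic belongs to [G] or
    is a cone vertex. *)
Lemma electric_ball_step (n : nat) (v x : vertex G) :
  electric_ball (S n) v x ->
  thickening G 1 (electric_ball n v) x \/
  exists c, (vdist EG (plain v) (cone c) <= n)%nat /\ member_vertices H c x.
Proof.
  unfold electric_ball. intros Hx.
  destruct (geodesic_path EG electrification_connected (plain v) (plain x))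
    as [g [H0 [Hn [Hg Hd]]]].
  destruct (vdist EG (plain v) (plain x)) as [| k] eqn:Hk.
  - left. exists x. split; [lia |]. rewrite vmetric_refl by exact Gconn. lra.
  - pose proof (Hg k (Nat.lt_succ_diag_r k)) as Hadj. rewrite Hn in Hadj.
    pose proof (Hd k (Nat.le_succ_diag_r k)) as Hdk.
    destruct (g k) as [y | c] eqn:Hgk.
    + left. exists y. split; [lia |]. apply (le_INR _ 1).
      apply vdist_adjacent; [exact Gconn |].
      now apply adjacent_sym, adjacent_plain.
    + right. exists c. split; [lia |]. now apply adjacent_cone, adjacent_sym.
Qed.

(** Away from the smaller ball, an [r]-ball meets at most one of these members, so the intrinsic
    covers of the members can be used together without adding their multiplicities. *)
Lemma members_scale_cover (n : nat) (r : R) :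
  exists K D, 1 <= K /\ forall v,
    scale_cover (vertex G) (vmetric G)
      (fun x => ~ thickening G K (electric_ball n v) x /\
        exists c, (vdist EG (plain v) (cone c) <= n)%nat /\ member_vertices H c x)
      r D mult.
Proof.
  (* Two points of one [r]-ball are at distance at most [2 * r] in [G], hence at most [rho] inside a
     common member; this is why the members are covered at scale [rho]. *)
  destruct (members_separated n (2 * r)) as [K [HK Hsep]].
  destruct (members_properly_embedded (2 * r)) as [rho [Hrho Hemb]].
  destruct (Hmembers rho Hrho) as [D HD].
  apply dependent_choice in HD. destruct HD as [U HU].
  exists K, D. split; [exact HK |]. intros v.
  pose (far := fun x => ~ thickening G K (electric_ball n v) x).
  pose (piece := fun c (A : vertex (member G H c) -> Prop) x =>
    far x /\ exists h, proj1_sig h = x /\ A h).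
  exists (fun B => exists c A, (vdist EG (plain v) (cone c) <= n)%nat /\ U c A /\
    B = piece c A). repeat split.
  - intros x [Hfar [c [Hc Hx]]]. destruct (HU c) as [Hcov _].
    destruct (Hcov (exist _ x Hx) I) as [A [HA HAx]].
    exists (piece c A). split; [exists c, A; auto |]. split; [exact Hfar |].
    exists (exist _ x Hx). auto.
  - intros B [c [A [Hc [HA ->]]]] x y [_ [h [<- Hh]]] [_ [h' [<- Hh']]].
    destruct (HU c) as [_ [Hbd _]]. pose proof (Hbd A HA h h' Hh Hh').
    pose proof (vdist_member_ge c h h'). lra.
  - intros x.
    destruct (classic (exists c (h : vertex (member G H c)),
      (vdist EG (plain v) (cone c) <= n)%nat /\ far (proj1_sig h) /\
      vmetric G x (proj1_sig h) <= r)) as [[c0 [h0 [Hc0 [Hfar0 Hh0]]]] | Hno].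
    + destruct (HU c0) as [_ [_ Hm]].
      generalize (at_most_image _ _ (piece c0) _ _ (Hm h0)).
      apply at_most_sub; [lia |].
      intros B [[c [A [Hc [HA ->]]]] [y [Hy [Hfar [h [<- Hh]]]]]].
      assert (Hhh : vmetric G (proj1_sig h0) (proj1_sig h) <= 2 * r).
      { pose proof (vmetric_triangle G Gconn (proj1_sig h0) x (proj1_sig h)).
        rewrite (vmetric_sym G Gconn (proj1_sig h0) x) in *. lra. }
      assert (c0 = c) as <-
        by (eapply Hsep; eauto; [exact (proj2_sig h0) | exact (proj2_sig h)]).
      exists A. split; [split; [exact HA |] | reflexivity].
      exists h. split; [| exact Hh]. now apply Hemb.
    + exists nil. split; [simpl; lia |].
      intros B [[c [A [Hc [HA ->]]]] [y [Hy [Hfar [h [<- Hh]]]]]].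
      apply Hno. eauto.
Qed.

(** The induction treats all scales at once, since the step calls the smaller ball at scale [r + K]
    with [K] depending on [r]. *)
Lemma electric_ball_scale_cover (n : nat) :
  forall r, exists D m, forall v,
    scale_cover (vertex G) (vmetric G) (electric_ball n v) r D m.
Proof.
  induction n as [| n IH]; intros r.
  - exists 0, 1%nat. intros v. exists (fun A => A = eq v). repeat split.
    + intros x Hx. exists (eq v). split; [reflexivity |].
      assert (E : plain v = plain x)
        by (apply vdist_eq0; [apply electrification_connected |];
            unfold electric_ball in Hx; lia).
      congruence.
    + intros A -> x y <- <-. rewrite vmetric_refl by exact Gconn. lra.
    + intros x. exists (eq v :: nil). split; [simpl; lia |].
      intros A [-> _]. now left.
  - destruct (members_scale_cover n r) as [K [D [HK HD]]].
    destruct (IH (r + K)) as [D' [m HD']].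
    exists (Rmax (D' + 2 * K) D), (m + mult)%nat. intros v.
    generalize (scale_cover_union _ _ _ _ _ _ _ _ _
      (scale_cover_thickening G Gconn K _ r D' m (HD' v)) (HD v)).
    apply scale_cover_sub. intros x Hx.
    destruct (classic (thickening G K (electric_ball n v) x)) as [Ht | Ht];
      [now left |].
    right. split; [exact Ht |].
    destruct (electric_ball_step n v x Hx) as [[y [Hy Hxy]] | Hc]; [| exact Hc].
    exfalso. apply Ht. exists y. split; [exact Hy | lra].
Qed.

(* [G -> EG] is 1-Lipschitz, so a cover of [EG] pulls back to [G]; each of its
   members lies in an electric ball, which has a good cover of its own. *)
Lemma relative_scale_cover (r D : R) (m : nat) :
  scale_cover (vertex EG) (vmetric EG) (fun _ => True) r D m ->
  exists D' m', scale_cover (vertex G) (vmetric G) (fun _ => True) r D' m'.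
Proof.
  intros [U [HU [HD Hm]]].
  destruct (INR_unbounded D) as [n Hn].
  destruct (electric_ball_scale_cover n r) as [D' [m' HW]].
  apply dependent_choice in HW. destruct HW as [W HW].
  (* A set without vertices of [G] gets an arbitrary centre; its trace on [G] is empty. *)
  destruct (dependent_choice _ (fun _ => vertex G)
    (fun (A : vertex EG -> Prop) v => (exists x, A (plain x)) -> A (plain v)))
    as [center Hcenter].
  { intros A. destruct (classic (exists x, A (plain x))) as [[x Hx] | Hno].
    - exists x. auto.
    - destruct Gconn as [[o] _]. exists o. tauto. }
  exists D', (m * m')%nat.
  exists (fun C => exists A B, U A /\ W (center A) B /\
    C = fun x => A (plain x) /\ B x). repeat split.
  - intros x _. destruct (HU (plain x) I) as [A [HA HAx]].
    destruct (HW (center A)) as [Hcov _]. destruct (Hcov x) as [B [HB HBx]].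
    + apply INR_le. eapply Rle_trans; [| apply Rlt_le, Hn].
      apply (HD A HA); [apply Hcenter; now exists x | exact HAx].
    + exists (fun x => A (plain x) /\ B x). split; [| auto]. exists A, B. auto.
  - intros C [A [B [HA [HB ->]]]] x y [_ Hx] [_ Hy].
    destruct (HW (center A)) as [_ [Hbd _]]. eapply Hbd; eauto.
  - intros x.
    pose (Q := fun A C => exists B, (W (center A) B /\
      ball_meets (vertex G) (vmetric G) r x B) /\ C = fun x => A (plain x) /\ B x).
    generalize (at_most_bind _ _ _ m' _ Q (Hm (plain x))
      (fun A _ => at_most_image _ _ _ _ _ (proj2 (proj2 (HW (center A))) x))).
    apply at_most_sub; [lia |].
    intros C [[A [B [HA [HB ->]]]] [y [Hy [HAy HBy]]]]. exists A. split.
    + split; [exact HA |]. exists (plain y). split; [| exact HAy].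
      eapply Rle_trans; [| exact Hy]. apply le_INR, vdist_plain_le.
    + exists B. split; [split; [exact HB |] | reflexivity]. exists y. auto.
Qed.

End BoundedPenetration.

Lemma hyperbolic_relative_finite_asdim :
  hyperbolic_graph G -> bounded_penetration G H ->
  (exists n, uniform_asdim_le (index H) (fun c => point (member G H c))
    (fun c => dist (member G H c)) n) ->
  finite_asdim (vertex EG) (vmetric EG) -> finite_asdim (vertex G) (vmetric G).
Proof.
  intros [delta [Hdelta Hyp]] Hpen [n Hn] [m Hm].
  rewrite asdim_le_scale_cover in Hm.
  (* Here [delta] is the constant of [G], not of [EG]: the pulled-back cover must serve in [G] at
     scale [4 * delta], and the pullback keeps the scale. *)
  destruct (Hm (4 * delta)) as [D HD]; [lra |].
  destruct (relative_scale_cover Hpen (S n)) with (2 := HD) as [D' [m' HD']].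
  - intros r Hr. destruct (Hn r Hr) as [D1 HD1]. exists (D1 + 0). intros c.
    destruct (HD1 c) as [U [Hcov [Hbd Hmul]]].
    apply scale_cover_pullback with (f := @Vert (member G H c))
      (dZ := dist (member G H c)); [intros; unfold vmetric; simpl; lra .. |].
    exists U. repeat split; auto. intros x. rewrite Rplus_0_r.
    destruct (Hmul x) as [l [Hl Hin]]. exists l. split; [exact Hl |].
    intros A [HA HxA]. auto.
  - exists (3 * m')%nat. apply hyperbolic_asdim_le with (delta := delta) (D := D');
      [exact Gconn | lra | | exact HD'].
    intros w x y z. exact (Hyp (Vert w) (Vert x) (Vert y) (Vert z)).
Qed.

End Electrification.

(** * Descent along the hierarchy *)

(** Adjacency ignores orientation, so the vertex bijection and its inverse both carry walks to walks
    and preserve distances. *)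
Lemma isomorphic_finite_asdim (G G' : graph) :
  connected G -> connected G' -> isomorphic G G' ->
  finite_asdim (vertex G) (vmetric G) -> finite_asdim (vertex G') (vmetric G').
Proof.
  intros Gconn G'conn [f [g [[f' [Hff' Hf'f]] [[g' [_ Hg'g]] Hfg]]]] [n Hn].
  exists n. revert Hn.
  assert (Hadj : forall u v, adjacent G u v -> adjacent G' (f u) (f v)).
  { intros u v [e He]. exists (g e).
    destruct (Hfg e) as [[-> ->] | [-> ->]], He as [[-> ->] | [-> ->]]; auto. }
  assert (Hadj' : forall u v, adjacent G' u v -> adjacent G (f' u) (f' v)).
  { intros u v [e He]. exists (g' e). pose proof (Hfg (g' e)) as Hs.
    rewrite Hg'g in Hs.
    destruct Hs as [[Hs Ht] | [Hs Ht]], He as [[<- <-] | [<- <-]];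
      rewrite Hs, Ht, !Hff'; auto. }
  assert (Hle : forall u v, (vdist G (f' u) (f' v) <= vdist G' u v)%nat).
  { intros u v. apply vdist_le; [exact Gconn |].
    apply walk_map with (1 := Hadj'). now apply vdist_walk. }
  assert (Hge : forall u v, (vdist G' u v <= vdist G (f' u) (f' v))%nat).
  { intros u v. apply vdist_le; [exact G'conn |].
    rewrite <- (Hf'f u) at 2. rewrite <- (Hf'f v) at 2.
    apply walk_map with (1 := Hadj). now apply vdist_walk. }
  apply asdim_le_pullback with (f := f') (a := 0); [lra | |];
    intros u v; rewrite Rplus_0_r; apply le_INR; auto.
Qed.

Theorem corollary1 (G : graph) (Gconn : connected G)
  (Ghyp : hyperbolic_graph G) (Gtame : exists h : hierarchy G, tame G h) :
  finite_asdim (point G) (dist G).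
Proof.
  destruct Gtame as [h [[n0 Hbase] Hfam]].
  (* The index is shifted because the base is level 1; electric level [S i] passes finiteness on to
     level [S (S i)]. *)
  assert (Hlevel : forall i, (S i <= depth h)%nat ->
    finite_asdim (vertex (level h (S i))) (vmetric (level h (S i)))).
  { induction i as [| i IH]; intros Hi.
    - exists n0. apply asdim_le_vertices; [| exact Hbase].
      apply (level_connected G h). lia.
    - assert (Hc : connected (level h (S (S i))))
        by (apply (level_connected G h); lia).
      apply hyperbolic_relative_finite_asdim with (H := family h (S i)).
      + exact Hc.
      + apply (level_hyperbolic G h). lia.
      + apply (level_relative G h). lia.
      + apply Hfam. lia.
      + apply isomorphic_finite_asdim with (G := level h (S i)).
        * apply (level_connected G h). lia.
        * now apply electrification_connected.
        * apply (level_electrification G h). lia.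
        * apply IH. lia. }
  pose proof (depth_pos G h) as Hpos.
  specialize (Hlevel (depth h - 1)%nat).
  replace (S (depth h - 1)) with (depth h) in Hlevel by lia.
  rewrite (level_top G h) in Hlevel.
  destruct (Hlevel (le_n _)) as [n Hn]. exists n.
  now apply asdim_le_vertices.
Qed.
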